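(* Every nontrivial limit group $L$ admits an uncountable set of minimal quasimorphisms whose classes in $\mathrm{HQM}(L;\mathbb{Z})$ form an uncountable, $\mathbb{Z}$-linearly independent set.
   Context: A limit group is a finitely generated group $L$ that is fully residually free: for every finite subset $Q\subseteq L$ there is a homomorphism from $L$ to a free group which is injective on $Q$. For $f\colon L\to\mathbb{Z}$ put $\partial f(g,h)=f(g)+f(h)-f(gh)$; $f$ is a quasimorphism if $\sup|\partial f|<\infty$. A minimal quasimorphism is an integer-valued subadditive defect-one quasimorphism, i.e. a map $\alpha\colon L\to\mathbb{Z}$ which is not a homomorphism and satisfies $\alpha(g)+\alpha(h)-\alpha(gh)\in\{0,1\}$ for all $g,h\in L$. $\mathrm{HQM}(L;\mathbb{Z})$ is the abelian group of quasimorphisms $L\to\mathbb{Z}$ modulo the subgroup generated by bounded maps $L\to\mathbb{Z}$ and homomorphisms $L\to\mathbb{Z}$. *)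

(* Defs.v *)
From HB Require Import structures.
From mathcomp Require Import all_boot all_order all_algebra ring_quotient ring.
From mathcomp Require Import boolp classical_sets functions cardinality.

Set Implicit Arguments.
Unset Strict Implicit.
Unset Printing Implicit Defensive.

Import Order.TTheory GRing.Theory Num.Theory.

Local Open Scope classical_set_scope.
Local Open Scope ring_scope.

(* [groupType] is the type of arbitrary, possibly infinite, groups.  Subsets are
   given by boolean predicates; under the classical axioms of [boolp] these are
   all the subsets. *)

Definition finitely_generated (G : groupType) : Prop :=
  exists s : seq G, forall H : {pred G},
    group_closed H -> {subset s <= H} -> forall g : G, g \in H.

Definition free_on (F : groupType) (X : Type) (i : X -> F) : Prop :=
  forall (G : groupType) (f : X -> G),
    exists2 phi : {multiplicative F -> G},
      (forall x, phi (i x) = f x) &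
      (forall psi : {multiplicative F -> G},
         (forall x, psi (i x) = f x) -> psi =1 phi).

Definition free_group (F : groupType) : Prop :=
  exists (X : Type) (i : X -> F), free_on i.

Definition fully_residually_free (L : groupType) : Prop :=
  forall Q : seq L, exists (F : groupType) (phi : {multiplicative L -> F}),
    free_group F /\ {in Q &, injective phi}.

Definition limit_group (L : groupType) : Prop :=
  finitely_generated L /\ fully_residually_free L.

Definition defect (L : groupType) (f : L -> int) (g h : L) : int :=
  f g + f h - f (g * h)%g.

Definition bounded_map (T : Type) (f : T -> int) : Prop :=
  exists M : int, forall x, `|f x| <= M.

Definition quasimorphism (L : groupType) (f : L -> int) : Prop :=
  exists M : int, forall g h, `|defect f g h| <= M.

Definition homomorphism (L : groupType) (f : L -> int) : Prop :=
  forall g h, f (g * h)%g = f g + f h.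

Definition minimal_quasimorphism (L : groupType) (a : L -> int) : Prop :=
  ~ homomorphism a /\ forall g h, defect a g h = 0 \/ defect a g h = 1.

Definition is_quasimorphism (L : groupType) : {pred L -> int} :=
  fun f => `[< quasimorphism f >].

Lemma is_quasimorphism_zmod_closed (L : groupType) :
  zmod_closed (@is_quasimorphism L).
Proof.
split; first by apply/asboolP; exists 0 => g h; rewrite /defect addr0 subr0 normr0.
move=> u v /asboolP[M hM] /asboolP[N hN]; apply/asboolP; exists (M + N) => g h.
have -> : defect (u - v) g h = defect u g h - defect v g h.
  have E x : (u - v) x = u x - v x by [].
  rewrite /defect !E; ring.
by rewrite (le_trans (ler_normB _ _))// lerD.
Qed.

HB.instance Definition _ (L : groupType) :=
  GRing.isZmodClosed.Build (L -> int) (@is_quasimorphism L)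
    (@is_quasimorphism_zmod_closed L).

(* The abelian group, under pointwise addition, of quasimorphisms L -> Z. *)
Record QM (L : groupType) := MkQM {
  qm_fun :> L -> int;
  _ : qm_fun \in @is_quasimorphism L }.

HB.instance Definition _ (L : groupType) := [isSub for @qm_fun L].
HB.instance Definition _ (L : groupType) := [Choice of QM L by <:].
HB.instance Definition _ (L : groupType) := [SubChoice_isSubZmodule of QM L by <:].

Definition generated_subgroup (V : zmodType) (A : set V) : {pred V} :=
  fun x => `[< forall H : {pred V},
                 zmod_closed H -> (forall y, A y -> y \in H) -> x \in H >].

Lemma generated_subgroup_zmod_closed (V : zmodType) (A : set V) :
  zmod_closed (generated_subgroup A).
Proof.
split; first by apply/asboolP => H [].
move=> x y /asboolP hx /asboolP hy; apply/asboolP => H cH AH.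
by apply: cH.2; [exact: hx | exact: hy].
Qed.

HB.instance Definition _ (V : zmodType) (A : set V) :=
  GRing.isZmodClosed.Build V (generated_subgroup A)
    (@generated_subgroup_zmod_closed V A).

Definition trivial_qm (L : groupType) : {pred QM L} :=
  generated_subgroup [set f : QM L | bounded_map f \/ homomorphism f].

HB.instance Definition _ (L : groupType) :=
  GRing.ZmodClosed.on (@trivial_qm L).

Definition HQM (L : groupType) : zmodType := Quotient.quot (@trivial_qm L).

Definition HQM_class (L : groupType) (f : QM L) : HQM L :=
  (\pi_(Quotient.quot (@trivial_qm L)) f)%qT.

Definition Z_linearly_independent (V : zmodType) (B : set V) : Prop :=
  forall (s : seq V) (c : V -> int),
    uniq s -> (forall v, v \in s -> B v) ->
    \sum_(v <- s) v *~ c v = 0 -> forall v, v \in s -> c v = 0.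

(* Main.v *)
Require Import Defs.
From HB Require Import structures.
From mathcomp Require Import all_boot all_order all_algebra zify ring lra.
From mathcomp Require Import boolp classical_sets functions cardinality.
From mathcomp Require Import Rstruct.
From Stdlib Require Runcountable.

Set Implicit Arguments.
Unset Strict Implicit.
Unset Printing Implicit Defensive.

Import Order.TTheory GRing.Theory Num.Theory.

Local Open Scope classical_set_scope.
Local Open Scope ring_scope.

(** The quasimorphisms come from the integers: if [f : L -> Z] is a nonzero
    homomorphism and [t] is a real number, rounding the real homomorphism
    [t * f] up gives the map [ceil (t * f)], and
    [ceil x + ceil y - ceil (x + y)] is always 0 or 1.  An integral combination
    of such maps is within bounded distance of the real homomorphism
    [(sum of c_t * t) * f].  If the combination is trivial in HQM, it is also
    within bounded distance of an integral homomorphism; two real homomorphisms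
    at bounded distance are equal, so, evaluating at a point [g0] with
    [f g0 <> 0], the number [(sum of c_t * t) * f g0] is an integer
    ([ceil_combination_trivial]).  Hence a set of reals that together with 1 is
    linearly independent over Z yields linearly independent classes.  A maximal
    such set exists by Zorn's lemma, and it is uncountable: every real is a
    quotient of an integral combination of its elements and of 1 by an integer,
    while the reals are uncountable ([uncountable_independent_mod_Z]).

    It remains to find [f].  Some homomorphism from [L] to a free group [F] is
    not trivial, so it is enough that every nontrivial subgroup of a free group
    maps onto an infinite cyclic group.  This is obtained without subgroup
    theory from a finite form of the Magnus embedding: a given [g <> 1] in [F]
    is a reduced product of powers [x_a ^ z_a] of [k] basis elements, and
    sending a basis element [x] to [1 + N_x], where [N_x] has an entry 1 just
    above the diagonal in each row [a] with [x_a = x], defines a representation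
    of [F] by unitriangular integer matrices for which the top right entry of
    the image of [g] is the product of the exponents [z_a], hence nonzero
    ([free_residually_unitriangular]).  For a nontrivial group of unitriangular
    matrices, take a superdiagonal as close to the diagonal as possible among
    those on which some element does not vanish: its entries are additive
    ([unitriangular_hom]). *)

(** * A basis generates its free group *)

Section SubgroupType.
Variables (G : groupType) (H : {pred G}).

(** The closure proof is an argument of the type so that the group structure
    below can be found from the type alone. *)
Record subgroup_type (cH : group_closed H) :=
  Subgroup { subgroup_val : G; _ : subgroup_val \in H }.

Variable cH : group_closed H.

HB.instance Definition _ := [isSub for @subgroup_val cH].
HB.instance Definition _ := [Choice of subgroup_type cH by <:].
HB.instance Definition _ :=
  SubChoice_isSubGroup.Build G H (subgroup_type cH) cH.

End SubgroupType.

(** The map of the basis into [H] extends to a homomorphism from [F] to [H].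
    Followed by the inclusion, it is an endomorphism of [F] fixing the basis,
    hence the identity, so its values, which lie in [H], are all of [F]. *)
Lemma free_on_ind (F : groupType) (X : Type) (i : X -> F) (H : {pred F}) :
  free_on i -> group_closed H -> (forall x, i x \in H) -> forall g, g \in H.
Proof.
move=> freeF cH iH g.
have [phi phiE _] := freeF (subgroup_type cH) (fun x => Subgroup cH (iH x)).
have [psi _ uniq_psi] := freeF F i.
pose chi : {multiplicative F -> F} := (val : subgroup_type cH -> F) \o phi.
rewrite [g](uniq_psi idfun)// -(uniq_psi chi) => [|x]; last by rewrite /chi /= phiE.
exact: valP.
Qed.

(** * The group of units of a ring *)

Section UnitGroup.
Variable R : unitRingType.

Record unit_group := UnitGroup { unit_val : R; unit_valP : unit_val \in GRing.unit }.

HB.instance Definition _ := [isSub for unit_val].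
HB.instance Definition _ := [Choice of unit_group by <:].

Let mul_subproof (u v : unit_group) : unit_val u * unit_val v \in GRing.unit.
Proof. by rewrite unitrMl unit_valP. Qed.
Let inv_subproof (u : unit_group) : (unit_val u)^-1 \in GRing.unit.
Proof. by rewrite unitrV unit_valP. Qed.
Let mulu u v := UnitGroup (mul_subproof u v).
Let oneu := UnitGroup (unitr1 R).
Let invu u := UnitGroup (inv_subproof u).

Let muluA : associative mulu.
Proof. by move=> u v w; apply: val_inj; rewrite /= mulrA. Qed.
Let mul1u : left_id oneu mulu.
Proof. by move=> u; apply: val_inj; rewrite /= mul1r. Qed.
Let mulu1 : right_id oneu mulu.
Proof. by move=> u; apply: val_inj; rewrite /= mulr1. Qed.
Let mulVu : left_inverse oneu invu mulu.
Proof. by move=> u; apply: val_inj; rewrite /= mulVr ?unit_valP. Qed.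
Let muluV : right_inverse oneu invu mulu.
Proof. by move=> u; apply: val_inj; rewrite /= mulrV ?unit_valP. Qed.

HB.instance Definition _ :=
  isGroup.Build unit_group muluA mul1u mulu1 mulVu muluV.

Lemma unit_valM (u v : unit_group) : unit_val (u * v)%g = unit_val u * unit_val v.
Proof. by []. Qed.
Lemma unit_valV (u : unit_group) : unit_val u^-1%g = (unit_val u)^-1.
Proof. by []. Qed.

End UnitGroup.

(** * Integer powers and reduced words *)

Definition zpow (G : groupType) (g : G) (z : int) : G :=
  match z with Posz n => (g ^+ n)%g | Negz n => (g ^- n.+1)%g end.

Lemma zpowSr (G : groupType) (g : G) (z : int) : zpow g (z + 1) = (zpow g z * g)%g.
Proof.
case: z => [n|[|n]].
- by rewrite -PoszD addn1 /= expgSr.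
- by rewrite /= mulVg.
- rewrite (_ : _ + _ = Negz n); last by rewrite !NegzE; lia.
  by rewrite /= [(g ^+ n.+2)%g]expgS invgM -mulgA mulVg mulg1.
Qed.

Lemma zpowD (G : groupType) (g : G) (m n : int) :
  zpow g (m + n) = (zpow g m * zpow g n)%g.
Proof.
elim/int_rect: n => [|n IHn|n IHn]; first by rewrite addr0 mulg1.
- by rewrite -addn1 PoszD addrA !zpowSr IHn mulgA.
- apply: (mulIg g); rewrite -mulgA -!zpowSr.
  have -> : m + - n.+1%:Z + 1 = m - n%:Z by lia.
  by have -> : - n.+1%:Z + 1 = - n%:Z by lia.
Qed.

Lemma multiplicative1 (G H : groupType) (f : {multiplicative G -> H}) :
  f 1%g = 1%g.
Proof. by apply: (mulgI (f 1%g)); rewrite -gmulfM !mulg1. Qed.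

Lemma multiplicative_zpow (G H : groupType) (f : {multiplicative G -> H}) g z :
  f (zpow g z) = zpow (f g) z.
Proof.
elim/int_rect: z => [|n IHn|n IHn]; first exact: multiplicative1.
- by rewrite -addn1 PoszD !zpowSr gmulfM IHn.
- apply: (mulIg (f g)); rewrite -gmulfM -!zpowSr.
  by have -> : - n.+1%:Z + 1 = - n%:Z by lia.
Qed.

Section Words.
Variables (F : groupType) (X : Type) (i : X -> F).

Definition word_eval (w : seq (X * int)) : F :=
  foldr (fun p g => zpow (i p.1) p.2 * g)%g 1%g w.

Lemma word_eval_cat u v : word_eval (u ++ v) = (word_eval u * word_eval v)%g.
Proof. by elim: u => [|p u IHu] /=; rewrite ?mul1g// IHu mulgA. Qed.

Lemma word_eval_rcons u p :
  word_eval (rcons u p) = (word_eval u * zpow (i p.1) p.2)%g.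
Proof. by rewrite -cats1 word_eval_cat /= mulg1. Qed.

Definition inv_word (w : seq (X * int)) := rev [seq (p.1, - p.2) | p <- w].

Lemma word_evalV w : word_eval (inv_word w) = (word_eval w)^-1%g.
Proof.
elim: w => [|p w IHw] /=; first by rewrite invg1.
rewrite /inv_word /= rev_cons word_eval_rcons -/(inv_word w) IHw invgM /=.
congr (_ * _)%g; apply: (mulIg (zpow (i p.1) p.2)).
by rewrite mulVg -zpowD addNr.
Qed.

Lemma word_eval_surj (g : F) : free_on i -> exists w, g = word_eval w.
Proof.
move=> freeF; pose H : {pred F} := fun g => `[< exists w, g = word_eval w >].
suff /asboolP : g \in H by [].
apply: (free_on_ind freeF) => [|x]; last first.
  by apply/asboolP; exists [:: (x, 1)]; rewrite /= expg1 mulg1.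
split=> [|_ _ /asboolP[u ->] /asboolP[v ->]]; first by apply/asboolP; exists [::].
by apply/asboolP; exists (u ++ inv_word v); rewrite word_eval_cat word_evalV.
Qed.

(** The letter [x0] serves only as the default value of [nth]. *)
Definition reduced (x0 : X) (w : seq (X * int)) : Prop :=
  (forall a, (a < size w)%N -> (nth (x0, 0) w a).2 != 0) /\
  (forall a, (a.+1 < size w)%N ->
     (nth (x0, 0) w a).1 <> (nth (x0, 0) w a.+1).1).

(** A word of minimal length is reduced: a syllable of exponent 0 could be
    deleted, and two adjacent syllables on the same letter could be merged. *)
Lemma reduced_word (g : F) : free_on i -> g <> 1%g ->
  exists x0 w, [/\ reduced x0 w, (0 < size w)%N & g = word_eval w].
Proof.
move=> freeF g1.
have exn : exists n, `[< exists2 w, size w = n & g = word_eval w >].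
  by have [w gw] := word_eval_surj g freeF; exists (size w); apply/asboolP; exists w.
have [n /asboolP[w sw gw] min_n] := ex_minnP exn.
have {exn min_n sw n} wmin v : (size v < size w)%N -> g <> word_eval v.
  move=> ltvw gv; have : (n <= size v)%N by apply/min_n/asboolP; exists v.
  by rewrite -sw leqNgt ltvw.
have [x0 w0] : exists (x0 : X), (0 < size w)%N.
  by case: w gw {wmin} => // p ? _; exists p.1.
exists x0, w; split=> //; pose d : X * int := (x0, 0); rewrite /reduced -/d.
split=> a la.
  apply/negP => /eqP wa0; apply: (wmin (take a w ++ drop a.+1 w)).
    by rewrite size_cat size_take size_drop la; lia.
  rewrite gw -{1}(cat_take_drop a w) (drop_nth d la) !word_eval_cat /=.
  by rewrite wa0 mul1g.
move=> eqa.
have la' := ltnW la.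
pose p := ((nth d w a).1, (nth d w a).2 + (nth d w a.+1).2).
apply: (wmin (take a w ++ p :: drop a.+2 w)).
  by rewrite size_cat /= size_take size_drop la'; lia.
rewrite gw -{1}(cat_take_drop a w) (drop_nth d la') (drop_nth d la).
by rewrite !word_eval_cat /= zpowD -eqa !mulgA.
Qed.

End Words.

(** * Unitriangular integer matrices *)

Section Unitriangular.
Variable k : nat.
Implicit Types A B : 'M[int]_k.+1.

Definition unitriangular A : Prop :=
  forall a b : 'I_k.+1, (b <= a)%N -> A a b = (a == b)%:R.

Lemma unitriangular1 : unitriangular 1.
Proof. by move=> a b _; rewrite mxE. Qed.

Lemma unitriangularM A B :
  unitriangular A -> unitriangular B -> unitriangular (A * B).
Proof.
move=> uA uB a b le_ba; rewrite mxE (bigD1 a)//= uA// eqxx mul1r uB//.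
rewrite big1 ?addr0// => c neq_ca.
have [le_ca|lt_ac] := leqP c a.
  by rewrite uA// eq_sym (negPf neq_ca) mul0r.
rewrite uB ?(leq_trans le_ba (ltnW lt_ac))//.
by rewrite -val_eqE /= gtn_eqF ?mulr0// (leq_ltn_trans le_ba).
Qed.

(** If all entries of [A] strictly between the diagonal and the [d]-th
    superdiagonal vanish, the only terms of [\sum_c A a c * B c b] that survive
    are those of [c = a] and [c = b]. *)
Lemma unitriangular_entryM A B d (a b : 'I_k.+1) :
  unitriangular A -> unitriangular B ->
  (forall a' b' : 'I_k.+1, (a' < b')%N -> (b' - a' < d)%N -> A a' b' = 0) ->
  (a < b)%N -> (b - a = d)%N -> (A * B) a b = A a b + B a b.
Proof.
move=> uA uB A0 lt_ab dE; have neq_ba : b != a by rewrite -val_eqE gtn_eqF.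
rewrite mxE (bigD1 a)//= (bigD1 b)//= (uA a a)// (uB b b)// !eqxx mul1r mulr1 [RHS]addrC addrA.
rewrite big1 ?addr0// => c /andP[neq_ca neq_cb].
have [le_ca|lt_ac] := leqP c a; first by rewrite uA// eq_sym (negPf neq_ca) mul0r.
have [le_bc|lt_cb] := leqP b c; first by rewrite uB// (negPf neq_cb) mulr0.
by rewrite A0 ?mul0r//; lia.
Qed.

(** With [d] the least index of a superdiagonal on which some [rho g] does not
    vanish, each entry of that superdiagonal is additive by
    [unitriangular_entryM]; one of them is not identically 0. *)
Lemma unitriangular_hom (G : groupType) (rho : G -> 'M[int]_k.+1) :
  {morph rho : g h / (g * h)%g >-> g * h} -> (forall g, unitriangular (rho g)) ->
  (exists g, rho g <> 1) ->
  exists2 f : G -> int, homomorphism f & exists g, f g <> 0.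
Proof.
move=> rhoM uni [g0 g0N1].
pose P d := `[< exists g, exists a b : 'I_k.+1,
  [/\ (a < b)%N, (b - a)%N = d & rho g a b <> 0] >].
have exP : exists d, P d.
  apply: contrapT => /forallNP noP; apply: g0N1; apply/matrixP => a b; rewrite mxE.
  have [le_ba|lt_ab] := leqP b a; first by rewrite uni.
  rewrite -val_eqE ltn_eqF//; apply: contrapT => nz.
  by apply: (noP (b - a)%N); apply/asboolP; exists g0, a, b.
have [d /asboolP[g [a [b [lt_ab dE nz]]]] dmin] := ex_minnP exP.
exists (fun h => rho h a b); last by exists g.
move=> h h'; rewrite rhoM; apply: unitriangular_entryM dE => // a' b' lt_ab' lt_d.
apply: contrapT => nz'; have : (d <= b' - a')%N.
  by apply/dmin/asboolP; exists h, a', b'.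
by rewrite leqNgt lt_d.
Qed.

Definition shift_mx (sel : pred nat) : 'M[int]_k.+1 :=
  \matrix_(a, b) ((b == a.+1 :> nat) && sel a)%:R.

(** A nonzero term of the square needs two consecutive selected rows; the bound
    [a.+1 < k] appears because the last row has no entry above the diagonal. *)
Lemma shift_mx_sq0 (sel : pred nat) :
  (forall a, (a.+1 < k)%N -> ~~ (sel a && sel a.+1)) ->
  shift_mx sel * shift_mx sel = 0.
Proof.
move=> sparse; apply/matrixP => a b; rewrite !mxE big1// => c _; rewrite !mxE.
case: eqP => [->|]; last by rewrite mul0r.
case: eqP => [bE|]; last by rewrite mulr0.
have := sparse a; rewrite -ltnS -bE ltn_ord => /(_ isT).
by case: (sel a); case: (sel a.+1); rewrite ?mul0r ?mulr0.
Qed.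

Lemma unitriangular_shift (z : int) sel : unitriangular (1 + shift_mx sel *~ z).
Proof.
move=> a b le_ba; rewrite -scaler_int !mxE.
by rewrite (ltn_eqF (_ : b < a.+1)%N)//= mulr0 addr0.
Qed.

Lemma mulmx_shift A sel (a b c : 'I_k.+1) :
  b = c.+1 :> nat -> (A * shift_mx sel) a b = A a c * (sel c)%:R.
Proof.
move=> bE; rewrite mxE (bigD1 c)//= mxE bE eqxx big1 ?addr0// => e neq_ec.
by rewrite mxE bE eqSS val_eqE eq_sym (negPf neq_ec) mulr0.
Qed.

End Unitriangular.

(** * Free groups are residually unitriangular *)

Lemma square0_unit (R : unitRingType) (N : R) (z : int) : N * N = 0 ->
  (1 + N *~ z) * (1 - N *~ z) = 1.
Proof.
move=> N2; rewrite mulrBr mulr1 mulrDl mul1r.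
by rewrite mulrzAl mulrzAr N2 !mul0rz addr0 addrK.
Qed.

Lemma square0_zpow (R : unitRingType) (N : R) (u : unit_group R) (z : int) :
  N * N = 0 -> unit_val u = 1 + N -> unit_val (zpow u z) = 1 + N *~ z.
Proof.
move=> N2 uE.
have posE n : unit_val (u ^+ n)%g = 1 + N *~ n.
  elim: n => [|n IHn]; first by rewrite addr0.
  rewrite expgSr unit_valM IHn uE mulrDr mulr1 mulrDl mul1r.
  by rewrite mulrzAl N2 mul0rz addr0 addrAC -addrA -mulrS.
case: z => n; first exact: posE.
apply: (mulrI (unit_valP (u ^+ n.+1)%g)).
by rewrite unit_valV mulrV ?unit_valP// posE NegzE mulrNz square0_unit.
Qed.

Section Magnus.
Variables (F : groupType) (X : Type) (i : X -> F) (freeF : free_on i).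
Variables (x0 : X) (w : seq (X * int)).
Hypothesis redw : reduced x0 w.
Local Notation k := (size w).

Let letter a := (nth (x0, 0) w a).1.
Let expo a := (nth (x0, 0) w a).2.

(** Row [a] carries an entry 1 just above the diagonal when the letter of index
    [a] is [x].  As adjacent letters of [w] differ, the square of this matrix is
    0, so the powers of [1 + N] are the matrices [1 + z N]. *)
Definition magnus_nilp (x : X) : 'M[int]_k.+1 :=
  shift_mx (size w) (fun a => `[< letter a = x >]).

Lemma magnus_nilp_sq0 x : magnus_nilp x * magnus_nilp x = 0.
Proof.
apply: shift_mx_sq0 => a la; apply/negP => /andP[/asboolP xa /asboolP xa'].
by apply: redw.2 la _; rewrite -/(letter a) -/(letter a.+1) xa xa'.
Qed.

Lemma magnus_unit x : 1 + magnus_nilp x \in GRing.unit.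
Proof.
apply/unitrP; exists (1 - magnus_nilp x).
have := square0_unit 1 (magnus_nilp_sq0 x); have := square0_unit (-1) (magnus_nilp_sq0 x).
by rewrite mulrNz opprK mulr1z.
Qed.

Lemma magnus_rep : exists rho : F -> 'M[int]_k.+1,
  [/\ {morph rho : g h / (g * h)%g >-> g * h}, rho 1%g = 1 &
      forall x z, rho (zpow (i x) z) = 1 + magnus_nilp x *~ z].
Proof.
have [psi psiE _] := freeF (fun x => UnitGroup (magnus_unit x)).
exists (fun g => unit_val (psi g)); split=> [g h||x z].
- by rewrite gmulfM.
- by rewrite multiplicative1.
by rewrite multiplicative_zpow psiE; apply: square0_zpow => //; exact: magnus_nilp_sq0.
Qed.

Variable rho : F -> 'M[int]_k.+1.
Hypothesis rhoM : {morph rho : g h / (g * h)%g >-> g * h}.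
Hypothesis rho1 : rho 1%g = 1.
Hypothesis rhoX : forall x z, rho (zpow (i x) z) = 1 + magnus_nilp x *~ z.

Lemma magnus_unitriangular g : unitriangular (rho g).
Proof.
have [v ->] := word_eval_surj g freeF.
elim: v => [|p v IHv] /=; first by rewrite rho1; exact: unitriangular1.
by rewrite rhoM; apply: unitriangularM => //; rewrite rhoX; exact: unitriangular_shift.
Qed.

(** Each factor [1 + z N] moves a column index by at most one step, so after [m]
    syllables the first row vanishes beyond column [m], and column [m] can only
    be reached by using every step: the step over syllable [a] contributes the
    exponent [expo a]. *)
Lemma magnus_row0 m : (m <= size w)%N -> forall b : 'I_k.+1, (m <= b)%N ->
  rho (word_eval i (take m w)) ord0 b = (b == m :> nat)%:R * \prod_(a < m) expo a.
Proof.
elim: m => [|m IHm] lt_m b le_mb.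
  by rewrite take0 rho1 mxE big_ord0 mulr1 -val_eqE eq_sym.
rewrite (take_nth (x0, 0))// word_eval_rcons rhoM rhoX mulrDr mulr1 mulrzAr.
have [c bE] : exists c : 'I_k.+1, b = c.+1 :> nat.
  have lt_c : (b.-1 < (size w).+1)%N by have := ltn_ord b; lia.
  by exists (Ordinal lt_c) => /=; lia.
rewrite -scaler_int mxE [X in _ + X]mxE /magnus_nilp (mulmx_shift _ _ _ bE) !IHm//; [|lia|lia|lia|lia].
rewrite big_ord_recr /= bE eqSS gtn_eqF; last lia.
rewrite mul0r add0r -/(letter m).
have [->|_] := eqVneq (c : nat) m; last by rewrite !mul0r mulr0.
(* Column [m.+1]: the syllable of index [m] selects its own row [m]. *)
by rewrite asboolT// !mul1r mulr1 mulrC intz.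
Qed.

Lemma magnus_corner_neq0 :
  rho (word_eval i w) ord0 ord_max <> 0.
Proof.
have := @magnus_row0 k (leqnn k) ord_max (leqnn k).
rewrite take_size /= eqxx mul1r => ->; apply/eqP.
by apply/prodf_neq0 => a _; apply: redw.1.
Qed.

End Magnus.

Lemma free_residually_unitriangular (F : groupType) (g : F) :
  free_group F -> g <> 1%g ->
  exists k (rho : F -> 'M[int]_k.+1),
    [/\ {morph rho : g h / (g * h)%g >-> g * h},
        forall h, unitriangular (rho h) & rho g <> 1].
Proof.
move=> [X [i freeF]] /(reduced_word freeF)[x0 [w [redw w0 gw]]].
have [rho [rhoM rho1 rhoX]] := magnus_rep freeF redw.
exists (size w), rho; split=> // [h|rhog].
  exact: (magnus_unitriangular freeF rhoM rho1 rhoX).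
apply: (magnus_corner_neq0 redw rhoM rho1 rhoX).
by rewrite -gw rhog mxE -val_eqE /= ltn_eqF.
Qed.

(** A homomorphism to a free group that separates [g] from 1, followed by a
    unitriangular representation that separates its image from 1, is a
    nontrivial unitriangular representation of [L]. *)
Lemma fully_residually_free_hom (L : groupType) :
  fully_residually_free L -> (exists g : L, g <> 1%g) ->
  exists2 f : L -> int, homomorphism f & exists g, f g <> 0.
Proof.
move=> frf [g g1]; have [F [phi [freeF phi_inj]]] := frf [:: g; 1%g].
have phig : phi g <> 1%g.
  rewrite -(multiplicative1 phi) => /phi_inj E.
  by apply/g1/E; rewrite !inE eqxx ?orbT.
have [k [rho [rhoM uni rhog]]] := free_residually_unitriangular freeF phig.
apply: (@unitriangular_hom k L (rho \o phi)); last by exists g.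
- by move=> h h' /=; rewrite gmulfM rhoM.
- by move=> h; apply: uni.
Qed.

(** * Uncountably many reals independent modulo the integers *)

Section IndependenceModZ.
Variable R : archiRealFieldType.
Implicit Types (T : set R) (s : seq R) (c : R -> int).

(** Linear independence over Z of the images in [R / Z], which is stronger than
    independence of [T] in [R]: 1 is treated as one more element of [T]. *)
Definition independent_mod_Z T : Prop := forall s c,
  uniq s -> (forall t, t \in s -> T t) ->
  \sum_(t <- s) t *~ c t \is a Num.int -> forall t, t \in s -> c t = 0.

Lemma chain_finite_subset (F : set (set R)) s : total_on F subset -> F !=set0 ->
  (forall t, t \in s -> (\bigcup_(T in F) T) t) ->
  exists2 T, F T & forall t, t \in s -> T t.
Proof.
move=> totF [T0 FT0]; elim: s => [|x s IHs] sF; first by exists T0.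
have [t ts|T FT sT] := IHs; first by apply: sF; rewrite inE ts orbT.
have [T' FT' T'x] := sF x (mem_head _ _).
have [TT'|T'T] := totF _ _ FT FT'.
  by exists T' => // t; rewrite inE => /orP[/eqP->//|/sT/TT'].
by exists T => // t; rewrite inE => /orP[/eqP->|/sT//]; exact: T'T.
Qed.

(** Independence involves finitely many elements at a time, so it passes to
    unions of chains. *)
Lemma maximal_independent_mod_Z : exists T, independent_mod_Z T /\
  forall T', T `<` T' -> ~ independent_mod_Z T'.
Proof.
apply: Zorn_bigcup => F FP totF s c us sF sum_int t ts.
have [T FT _] := sF t ts.
have [|T' FT' sT'] := chain_finite_subset totF _ sF; first by exists T.
exact: (FP _ FT' s).
Qed.

(** A triple [(m, b, l)] encodes the solution [r] of
    [b r + \sum_((n, z) <- l) z * e n = m], where [e] enumerates the known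
    reals. *)
Definition combination_decode (e : nat -> R) (x : int * int * seq (nat * int)) : R :=
  (x.1.1%:~R - \sum_(p <- x.2) e p.1 *~ p.2) / x.1.2%:~R.

(** Let [T] be maximal and [r] a real outside [T].  A dependence relation in
    [r |: T] must involve [r], with a nonzero coefficient, and can be solved for
    [r].  If [T] were countable, [combination_decode] would then enumerate all
    reals from a countable type. *)
Lemma uncountable_independent_mod_Z : ~ countable [set: R] ->
  exists T, ~ countable T /\ independent_mod_Z T.
Proof.
move=> uncR; have [T [indT maxT]] := maximal_independent_mod_Z.
exists T; split=> // /countable_injP[f f_inj]; apply: uncR.
pose e n : R := xget 0 [set t | T t /\ f t = n].
have eK t : T t -> e (f t) = t.
  move=> Tt; have [Te fe] := xgetI 0 (conj Tt erefl : [set u | T u /\ f u = f t] t).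
  by apply: f_inj; rewrite ?inE.
suff decode_surj : [set: R] `<=` range (combination_decode e).
  apply: sub_countable (subset_card_le decode_surj) _.
  exact: sub_countable (card_image_le _ _) (countableP _).
move=> r _; have [Tr|NTr] := pselect (T r).
  exists (0, 1, [:: (f r, -1)]) => //.
  by rewrite /combination_decode /= big_seq1 eK// mulrN1z sub0r opprK divr1.
have : ~ independent_mod_Z (T `|` [set r]).
  by apply: maxT; split=> [t Tt|/(_ r)]; [left|move=> /(_ (or_intror erefl))].
move=> /existsNP[s /existsNP[c /not_implyP[us /not_implyP[sT /not_implyP[]]]]].
move=> /intrP[m sumE] /existsNP[t /not_implyP[ts ct]].
have rem_sum s' : {subset s' <= s} -> r \notin s' -> forall u, u \in s' -> T u.
  move=> s's Nrs' u us'; have [//|/= ur] := sT u (s's u us').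
  by rewrite -ur us' in Nrs'.
have rs : r \in s.
  apply: contra_notT ct => Nrs.
  by apply: (indT s c us (rem_sum s _ Nrs)) ts; rewrite // sumE intr_int.
have sumE' : r *~ c r + \sum_(u <- rem r s) u *~ c u = m%:~R.
  by rewrite -sumE (perm_big _ (perm_to_rem rs)) big_cons.
have remT : forall u, u \in rem r s -> T u.
  by apply: rem_sum; [exact: mem_rem | rewrite mem_rem_uniq// inE eqxx].
have cr : c r != 0.
  apply/eqP => cr; move: sumE'; rewrite cr mulr0z add0r => sumE'.
  apply: ct; have [->//|tr] := eqVneq t r.
  apply: (indT (rem r s) c); rewrite ?rem_uniq ?sumE' ?intr_int//.
  by rewrite mem_rem_uniq// inE tr.
exists (m, c r, [seq (f u, c u) | u <- rem r s]) => //.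
rewrite /combination_decode /= big_map.
rewrite [X in _ - X](_ : _ = \sum_(u <- rem r s) u *~ c u); last first.
  by apply: eq_big_seq => u /remT/eK ->.
by rewrite -sumE' addrK -mulrzr mulfK// intr_eq0.
Qed.

End IndependenceModZ.

Lemma uncountable_R : ~ countable [set: Rdefinitions.R].
Proof.
move=> cR; have infR : infinite_set [set: Rdefinitions.R].
  apply/infiniteP; apply: card_le_trans (subset_card_le (@subsetT _ (range (fun n : nat => n%:R : Rdefinitions.R)))).
  have inj : {in [set: nat] &, injective (fun n : nat => n%:R : Rdefinitions.R)}.
    by move=> m n _ _ /eqP; rewrite eqr_nat => /eqP.
  by have := inj_card_eq inj; rewrite card_eq_le => /andP[].
have /card_set_bijP[v] := eq_card_nat cR infR.
rewrite setTT_bijective => -[u vK uK].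
by apply: (Runcountable.R_uncountable u); exists v.
Qed.

(** * Trivial classes *)

Lemma homomorphismX (L : groupType) (h : L -> int) g n :
  homomorphism h -> h (g ^+ n)%g = h g *+ n.
Proof.
move=> hM; have h1 : h 1%g = 0 by apply: (addrI (h 1%g)); rewrite -hM mulg1 addr0.
by elim: n => [|n IHn]; rewrite ?expg0// expgS hM IHn mulrS.
Qed.

Section TrivialQuasimorphisms.
Variable L : groupType.
Implicit Types (u v : QM L) (g : L).

(** Evaluation is named because the additive structure of [QM L] is then
    available for it, and it commutes with sums and multiples. *)
Definition qm_eval g u : int := u g.

Lemma qm_eval_is_zmod_morphism g : zmod_morphism (qm_eval g).
Proof. by []. Qed.

HB.instance Definition _ g :=
  GRing.isZmodMorphism.Build (QM L) int (qm_eval g) (qm_eval_is_zmod_morphism g).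

Lemma HQM_class_is_zmod_morphism : zmod_morphism (@HQM_class L).
Proof. by move=> u v; rewrite /HQM_class raddfB. Qed.

HB.instance Definition _ :=
  GRing.isZmodMorphism.Build (QM L) (HQM L) (@HQM_class L) HQM_class_is_zmod_morphism.

Lemma HQM_class_eq0 u : HQM_class u = 0 -> u \in @trivial_qm L.
Proof.
move=> u0; rewrite -[u]subr0 Quotient.idealrBE; apply/eqP.
by rewrite -[LHS]/(HQM_class u) u0 raddf0.
Qed.

Lemma homomorphism_trivial_qm u : homomorphism u -> u \in @trivial_qm L.
Proof.
move=> hu; apply: (introT (asboolP _)) => H _ genH.
by apply: genH; right.
Qed.

(** The quasimorphisms at bounded distance from a homomorphism form a subgroup
    that contains the bounded maps and the homomorphisms. *)
Lemma trivial_qm_close u : u \in @trivial_qm L ->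
  exists2 h : L -> int, homomorphism h & bounded_map (fun g => u g - h g).
Proof.
pose H : {pred QM L} := fun u => `[< exists2 h : L -> int,
  homomorphism h & bounded_map (fun g => u g - h g) >].
move=> /asboolP uH; suff /asboolP : u \in H by [].
apply: uH => [|v [[M vM]|hv]]; last first.
- by apply/asboolP; exists v => //; exists 0 => g; rewrite subrr normr0.
- apply/asboolP; exists (fun=> 0) => [g g'|]; first by rewrite addr0.
  by exists M => g; rewrite subr0.
split=> [|v w /asboolP[h hM [M vM]] /asboolP[k kM [N wN]]].
  apply/asboolP; exists (fun=> 0) => [g g'|]; first by rewrite addr0.
  by exists 0 => g; rewrite subr0 -[X in `|X|]/(qm_eval g 0) raddf0.
apply/asboolP; exists (fun g => h g - k g) => [g g'|].
  by rewrite hM kM; ring.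
exists (M + N) => g.
have -> : (v - w) g - (h g - k g) = (v g - h g) - (w g - k g).
  by rewrite -[(v - w) g]/(v g - w g); ring.
exact: le_trans (ler_normB _ _) (lerD _ _).
Qed.

End TrivialQuasimorphisms.

(** * Rounding multiples of an integral homomorphism *)

Section CeilQuasimorphisms.
Variables (R : archiRealFieldType) (L : groupType) (f : L -> int).
Hypothesis fM : homomorphism f.

Definition ceil_map (t : R) (g : L) : int := Num.ceil (t * (f g)%:~R).

Lemma ceil_defect t g h : defect (ceil_map t) g h = 0 \/ defect (ceil_map t) g h = 1.
Proof.
rewrite /defect /ceil_map fM intrD mulrDr.
set x := t * _; set y := t * _.
have /andP[x1 x2] := ceil_itv x; have /andP[y1 y2] := ceil_itv y.
have /andP[z1 z2] := ceil_itv (x + y).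
move: x1 x2 y1 y2 z1 z2; rewrite !intrD !rmorphN /=.
move: (Num.ceil x) (Num.ceil y) (Num.ceil (x + y)) => a b c *.
have : a + b - c < 2%:Z by rewrite -(ltr_int R) !intrD rmorphN /=; lra.
have : -1 < a + b - c by rewrite -(ltr_int R) !intrD !rmorphN /=; lra.
lia.
Qed.

Lemma ceil_map_qm t : ceil_map t \in @is_quasimorphism L.
Proof.
by apply/asboolP; exists 1 => g h; have [->|->] := ceil_defect t g h.
Qed.

Definition ceil_qm t : QM L := MkQM (ceil_map_qm t).

(** Rounding changes each term by at most [`|c t|]. *)
Lemma ceil_combination_close (s : seq R) (c : R -> int) : exists K : R, forall g,
  `|(\sum_(t <- s) ceil_map t g *~ c t)%:~R - (\sum_(t <- s) t *~ c t) * (f g)%:~R| <= K.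
Proof.
exists (\sum_(t <- s) `|(c t)%:~R|) => g.
rewrite rmorph_sum /= mulr_suml -sumrB.
apply: le_trans (ler_norm_sum _ _ _) _; apply: ler_sum => t _.
rewrite (_ : _ - _ = ((ceil_map t g)%:~R - t * (f g)%:~R) * (c t)%:~R); last first.
  by rewrite -(mulrzr (ceil_map t g)) intz -(mulrzr t) intrM; ring.
rewrite normrM ler_piMl// /ceil_map; have := ceil_itv (t * (f g)%:~R).
rewrite intrD rmorphN /= => /andP[x1 x2].
by rewrite ger0_norm; lra.
Qed.

Variable g0 : L.

(** The combination is close both to [r * f], with [r] the sum of the
    [t *~ c t], and to an integral homomorphism [h].  On the powers of [g0] the
    difference [r * f - h] grows linearly unless it vanishes at [g0], so
    [r * f g0] is the integer [h g0]. *)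
Lemma ceil_combination_trivial (s : seq R) (c : R -> int) :
  \sum_(t <- s) ceil_qm t *~ c t \in @trivial_qm L ->
  \sum_(t <- s) t *~ (f g0 * c t) \is a Num.int.
Proof.
move=> /trivial_qm_close[h hM [M closeM]].
have [K closeK] := ceil_combination_close s c.
have evalE g : (\sum_(t <- s) ceil_qm t *~ c t) g = \sum_(t <- s) ceil_map t g *~ c t.
  rewrite -[LHS]/(qm_eval g _) raddf_sum; apply: eq_bigr => t _.
  by rewrite raddfMz.
set r := \sum_(t <- s) t *~ c t in closeK *.
have close g : `|r * (f g)%:~R - (h g)%:~R| <= K + M%:~R.
  have := closeK g; have := closeM g; rewrite evalE -(ler_int R) intr_norm intrB.
  move=> le1 le2; rewrite [K + _]addrC.
  set a := (X in X - (h g)%:~R) in le1.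
  rewrite (_ : _ - _ = (a - (h g)%:~R) - (a - r * (f g)%:~R)); last by ring.
  exact: le_trans (ler_normB _ _) (lerD _ _).
suff /eqP : r * (f g0)%:~R - (h g0)%:~R == 0.
  move=> /subr0_eq rE; rewrite (_ : \sum_(t <- s) _ = (h g0)%:~R) ?intr_int// -rE.
  rewrite mulr_suml; apply: eq_bigr => t _.
  by rewrite -(mulrzr t) -(mulrzr t (c t)) intrM; ring.
rewrite -normr_eq0; set y := `|_|; apply: contraT => y0.
have {}y0 : 0 < y by rewrite lt_def y0 normr_ge0.
have K0 : 0 <= K + M%:~R by apply: le_trans (close g0); exact: normr_ge0.
(* The power [n] is chosen so that [n * y] exceeds the bound on the distance. *)
have := archi_boundP (divr_ge0 K0 (ltW y0)); set n := Num.bound _.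
rewrite ltr_pdivrMr// ltNge => /negP[]; apply: le_trans (close (g0 ^+ n)%g).
rewrite !homomorphismX// !rmorphMn /= mulrnAr -mulrnBl normrMn.
by rewrite -/y mulr_natl.
Qed.

Hypothesis fg0 : f g0 <> 0.
Variable T : set R.
Hypothesis indT : independent_mod_Z T.

Lemma ceil_independent (s : seq R) (c : R -> int) : uniq s ->
  (forall t, t \in s -> T t) ->
  \sum_(t <- s) ceil_qm t *~ c t \in @trivial_qm L ->
  forall t, t \in s -> c t = 0.
Proof.
move=> us sT /ceil_combination_trivial int_sum t ts; apply/eqP.
have /eqP := indT us sT int_sum ts.
by rewrite mulf_eq0 => /orP[/eqP/fg0|].
Qed.

(** If [ceil_qm t] were a homomorphism, its class would be 0, a linear relation
    with the single coefficient 1. *)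
Lemma ceil_qm_minimal t : T t -> minimal_quasimorphism (ceil_qm t).
Proof.
move=> Tt; split; last exact: ceil_defect.
move=> hom; suff : 1 = 0 :> int by [].
apply: (@ceil_independent [:: t] (fun=> 1) _ _ _ t); rewrite ?mem_head//.
  by move=> t'; rewrite inE => /eqP->.
by rewrite big_seq1 mulr1z; exact: homomorphism_trivial_qm.
Qed.

Lemma HQM_class_ceil_inj : {in T &, injective (fun t => HQM_class (ceil_qm t))}.
Proof.
move=> t t'; rewrite !inE => Tt Tt' eq_class; apply/eqP/negPn/negP => neq.
pose c x : int := if x == t then 1 else -1.
have : c t = 0; last by rewrite /c eqxx.
apply: (@ceil_independent [:: t; t'] c _ _ _ t); rewrite ?mem_head//=; first by rewrite inE neq.
  by move=> x; rewrite !inE => /orP[] /eqP->.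
apply: HQM_class_eq0; rewrite !big_cons big_nil addr0 raddfD /c eqxx.
by rewrite eq_sym (negPf neq) mulrN1z raddfN /= eq_class subrr.
Qed.

Lemma HQM_class_ceil_independent :
  Z_linearly_independent (@HQM_class L @` (ceil_qm @` T)).
Proof.
move=> s c us sS sum0 v vs.
pose rep v : R := xget 0 [set t | T t /\ HQM_class (ceil_qm t) = v].
have repP x : x \in s -> T (rep x) /\ HQM_class (ceil_qm (rep x)) = x.
  move=> /sS[_ [t Tt <-] tx].
  exact: (xgetI 0 (conj Tt tx : [set u | T u /\ HQM_class (ceil_qm u) = x] t)).
have repK x : x \in s -> HQM_class (ceil_qm (rep x)) = x by case/repP.
rewrite -(repK v vs); apply: (@ceil_independent (map rep s)
  (fun t => c (HQM_class (ceil_qm t)))).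
- rewrite map_inj_in_uniq// => x y /repK {2}<- /repK {2}<- ->//.
- by move=> _ /mapP[x /repP[? _] ->].
- apply: HQM_class_eq0; rewrite raddf_sum big_map -[RHS]sum0.
  by apply: eq_big_seq => x /repK xE; rewrite raddfMz /= xE.
- exact: map_f.
Qed.

End CeilQuasimorphisms.

Theorem corollary1p13 (L : groupType) (hL : limit_group L)
    (hnontriv : exists g : L, g <> 1%g) :
  exists S : set (QM L),
    [/\ forall a, S a -> minimal_quasimorphism a,
        ~ countable S,
        ~ countable (@HQM_class L @` S) &
        Z_linearly_independent (@HQM_class L @` S)].
Proof.
have [f fM [g0 fg0]] := fully_residually_free_hom hL.2 hnontriv.
have [T [uncT indT]] := uncountable_independent_mod_Z uncountable_R.
have unc_class : ~ countable (@HQM_class L @` (ceil_qm fM @` T)).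
  rewrite image_comp.
  by rewrite (eq_countable (inj_card_eq (HQM_class_ceil_inj (fM := fM) fg0 indT))).
exists (ceil_qm fM @` T); split=> //.
- by move=> _ [t Tt <-]; exact: (ceil_qm_minimal fM fg0 indT).
- by move=> cS; apply: unc_class; apply: sub_countable (card_image_le _ _) cS.
- exact: (HQM_class_ceil_independent (fM := fM) fg0 indT).
Qed.
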